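(* Let $\theta>0$ be a constant and suppose that for each $N\in\mathbb{N}$ the composition of the surplus capacity distribution function and the load surge function satisfies $F(l^N(i))=\frac{\theta+i-1}{N}$ (to be read as $\min\{1,\frac{\theta+i-1}{N}\}$), $i=1,\dots,N$. Let $k_\star:=k_\star(N)$ and $k^\star:=k^\star(N)$ be functions of $N$ with $k^\star\ge k_\star$, $k_\star\to\infty$ and $N-k^\star\to\infty$ as $N\to\infty$. Then $$\lim_{N\to\infty}\ \sup_{k\in[k_\star,k^\star]}\left|k^{3/2}\sqrt{1-k/N}\;\mathbb{P}(A^N=k)-\frac{\theta}{\sqrt{2\pi}}\right|=0,$$ where the supremum runs over the integers $k\in[k_\star,k^\star]$ (the supremum over an empty set being $0$).
   Context: Model. For each $N\in\mathbb{N}$ a network has $N$ lines with i.i.d. surplus capacities $C^N(1),\dots,C^N(N)$ having a common continuous distribution function $F$ with strictly positive density at zero. Let $C^N_{(1)}\le\dots\le C^N_{(N)}$ be the ordered surplus capacities. The load surge function $l^N(\cdot)$ is deterministic and increasing. The number of failed lines (blackout size) is $A^N=\max\{k\in\{1,\dots,N\}: C^N_{(i)}\le l^N(i)\text{ for all } i=1,\dots,k\}$, and $A^N=0$ if $C^N_{(1)}>l^N(1)$. Equivalently in distribution, $\mathbb{P}(A^N\ge k)=\mathbb{P}(U^N_{(i)}\le F(l^N(i)),\ i=1,\dots,k)$ for integers $1\le k\le N$, where $U^N_{(1)}\le\dots\le U^N_{(N)}$ are the order statistics of $N$ independent uniform random variables on $[0,1]$. *)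

(* Defs.v *)
From HB Require Import structures.
From mathcomp Require Import all_boot all_order all_algebra.
From mathcomp Require Import all_classical all_reals all_analysis.

Set Implicit Arguments.
Unset Strict Implicit.
Unset Printing Implicit Defensive.

Import Order.TTheory GRing.Theory Num.Theory.
Import numFieldNormedType.Exports.

Local Open Scope classical_set_scope.
Local Open Scope ring_scope.

Definition mutually_independent (d : measure_display) (T : measurableType d)
    (R : realType) (P : probability T R) (I : finType)
    (X : I -> {RV P >-> R}) : Prop :=
  forall (J : {set I}) (B : I -> set R),
    (forall j, j \in J -> measurable (B j)) ->
    P [set w | forall j, j \in J -> B j (X j w)] =
      (\prod_(j in J) P (X j @^-1` B j))%E.

(* [F] is unconstrained to the left of 0: nonnegative variables are allowed to
   have a density that jumps at 0. *)
Definition positive_density_at0 (R : realType) (F : R -> R) : Prop :=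
  exists2 f0 : R, 0 < f0 & (h^-1 * (F h - F 0)) @[h --> 0^'+] --> f0.

(* The order statistics are numbered from 1, as are the arguments of [l]
   in [blackout_size]. *)
Definition order_stat (R : realType) (N : nat) (c : 'I_N -> R) (i : nat) : R :=
  nth 0 (sort <=%R (codom c)) i.-1.

(* The maximum of the empty set of candidates [k] is 0. *)
Definition blackout_size (R : realType) (N : nat) (l : nat -> R)
    (c : 'I_N -> R) : nat :=
  \max_(1 <= k < N.+1 | all (fun i => order_stat c i <= l i) (iota 1 k)) k.

(* Main.v *)
Require Import Defs.
From HB Require Import structures.
From mathcomp Require Import all_boot all_order all_algebra.
From mathcomp Require Import all_classical all_reals all_analysis.
From mathcomp Require Import ring lra zify.

(** Put p_i := (theta + i - 1) / N, and let S be a set of k lines. The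
    probability that the i-th smallest of the capacities in S is at most l(i)
    for all i <= k turns out to be theta (theta + k)^(k-1) / N^k. Given this, the
    event that the blackout has size k says that some set S of k lines fails
    in this sense while every other line has capacity above l(k+1); such an S is
    unique, so summing over S gives the quasi-binomial law
      N^N P(A = k) = 'C(N, k) theta (theta + k)^(k-1) (N - theta - k)^(N-k)
    (quasi_binomial_blackout_size).

    The value theta (theta + k)^(k-1) / N^k comes from a renewal argument. Run
    the cascade inside S alone: it stops at exactly one subset J of S
    (sum_halts), and the failure of J is independent of the survival of S \ J. Hence
    the weights e_J of the failing sets satisfy
      1 = sum_(J <= S) e_J (1 - p_(|J|+1))^(|S|-|J|)
    for every S, which determines e_S recursively, and Abel's generalization of
    the binomial theorem (abel_identity) says that theta (theta + k)^(k-1) / N^k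
    is the solution (cascade_weightE). Only the position of each capacity among
    the levels l(1) <= ... <= l(N) matters, so all this takes place in a finite
    product space of cells; prob_blackout_size makes the link.

    For the asymptotics write n! = s(n) sqrt(n) (n/e)^n and m = N - k. In
    k^(3/2) sqrt(1 - k/N) P(A = k) all powers cancel and what remains is
    theta s(k + m) u(k) v(m), where u(k) tends to e^theta / sqrt(2 pi), v(m)
    tends to e^(-theta) / sqrt(2 pi) and s(n) to sqrt(2 pi). This is a limit as k
    and m tend to infinity independently of each other, hence it is uniform over
    k_lo <= k <= k_hi. Stirling's formula s(n) --> sqrt(2 pi) is proved by
    monotonicity of ln s(n), and the constant by Wallis' product. *)

Set Implicit Arguments.
Unset Strict Implicit.
Unset Printing Implicit Defensive.

Import Order.TTheory GRing.Theory Num.Theory.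
Import numFieldNormedType.Exports.

Local Open Scope classical_set_scope.
Local Open Scope ring_scope.

(** * Stirling's formula *)

Lemma is_derive_ge0_le (R : realType) (f df : R -> R) (a b : R) :
  a <= b -> (forall x, a <= x <= b -> is_derive x 1 f (df x)) ->
  (forall x, a <= x <= b -> 0 <= df x) -> f a <= f b.
Proof.
move=> ab fdf df0; have [||c cab fE] := @MVT_segment R f df a b ab.
- move=> x; rewrite in_itv/= => /andP[/ltW ax /ltW xb].
  by apply: fdf; rewrite ax.
- apply: derivable_within_continuous => x; rewrite in_itv/= => xab.
  by have [] := fdf _ xab.
- by rewrite -subr_ge0 fE mulr_ge0 ?subr_ge0// df0//; move: cab; rewrite in_itv.
Qed.

(** The midpoint rule underestimates the integral of the convex function 1/u over
    [1, t]: the bound is (t - 1) times the value of 1/u at (1 + t) / 2. *)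
Lemma ln_ge_midpoint (R : realType) (t : R) : 1 <= t ->
  2 - 4 / (1 + t) <= ln t.
Proof.
move=> t1; pose f := fun x : R => ln x + 4 * (1 + x)^-1.
have fD x : 1 <= x <= t ->
    is_derive x 1 f (x^-1 - 4 / (1 + x) ^+ 2).
  move=> /andP[x1 _]; have x0 : 0 < x by lra.
  have x10 : 0 < 1 + x by lra.
  have h1 : is_derive x 1 (fun x : R => 1 + x) (0 + 1).
    exact: is_deriveD.
  have h2 : is_derive x 1 (fun x : R => (1 + x)^-1) (- (1 + x) ^- 2 *: (0 + 1)).
    by apply: is_deriveV; rewrite gt_eqF//; lra.
  apply: (is_derive_eq (is_deriveD (is_derive1_ln x0) (is_deriveZ 4 h2))).
  by rewrite /GRing.scale/=; field; rewrite !gt_eqF.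
have := is_derive_ge0_le t1 fD.
have -> : f 1 = 2 by rewrite /f ln1; field.
rewrite /f -lerBlDr => -> // x /andP[x1 _].
have x0 : 0 < x by lra.
have x10 : 0 < 1 + x by lra.
rewrite (_ : _ - _ = ((x - 1) ^+ 2) / (x * (1 + x) ^+ 2)); last by field; rewrite !gt_eqF.
by rewrite divr_ge0 ?sqr_ge0// mulr_ge0 ?sqr_ge0//; lra.
Qed.

(** The trapezoidal rule overestimates the same integral. *)
Lemma ln_le_trapezoid (R : realType) (t : R) : 1 <= t ->
  ln t <= 2^-1 * (t - t^-1).
Proof.
move=> t1; pose f := fun x : R => 2^-1 * (x - x^-1) - ln x.
have fD x : 1 <= x <= t ->
    is_derive x 1 f ((1 + x ^- 2) * 2^-1 - x^-1).
  move=> /andP[x1 _]; have x0 : 0 < x by lra.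
  have x10 : 0 < 1 + x by lra.
  have h2 : is_derive x 1 (fun x : R => x^-1) (- x ^- 2 *: 1).
    by apply: is_deriveV; rewrite gt_eqF//; lra.
  have h3 : is_derive x 1 (fun x : R => x - x^-1) (1 - (- x ^- 2 *: 1)).
    exact: is_deriveB.
  have h4 : is_derive x 1 (fun x : R => 2^-1 * (x - x^-1))
      (2^-1 *: (1 - (- x ^- 2 *: 1))) by exact: is_deriveZ.
  apply: (is_derive_eq (is_deriveB h4 (is_derive1_ln x0))).
  by rewrite /GRing.scale/=; field; rewrite !gt_eqF.
have := is_derive_ge0_le t1 fD.
have -> : f 1 = 0 by rewrite /f ln1 invr1; ring.
rewrite /f subr_ge0 => -> // x /andP[x1 _].
have x0 : 0 < x by lra.
have x10 : 0 < 1 + x by lra.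
rewrite (_ : _ - _ = ((x - 1) ^+ 2) / (2 * x ^+ 2)); last by field; rewrite !gt_eqF.
by rewrite divr_ge0 ?sqr_ge0// mulr_ge0 ?sqr_ge0//; lra.
Qed.

Section Stirling.
Variable R : realType.
Implicit Types n : nat.

Definition stirling_ratio n : R :=
  n`!%:R / (Num.sqrt n%:R * (n%:R / expR 1) ^+ n).

Lemma stirling_ratio_gt0 n : (0 < n)%N -> 0 < stirling_ratio n.
Proof.
move=> n0; rewrite /stirling_ratio divr_gt0 ?ltr0n ?fact_gt0//.
by rewrite mulr_gt0 ?sqrtr_gt0 ?ltr0n// exprn_gt0// divr_gt0 ?ltr0n ?expR_gt0.
Qed.

Let log_ratio n := ln (stirling_ratio n.+1).

Let log_ratioE n : log_ratio n =
  ln (n.+1)`!%:R - (n.+1%:R + 2^-1) * ln n.+1%:R + n.+1%:R :> R.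
Proof.
have n0 : 0 < n.+1%:R :> R by rewrite ltr0n.
have e0 : 0 < n.+1%:R / expR 1 :> R by rewrite divr_gt0 ?expR_gt0.
have sqrtE : ln (Num.sqrt n.+1%:R) = 2^-1 * ln n.+1%:R :> R.
  apply: (@mulfI _ 2); first by rewrite pnatr_eq0.
  rewrite mulrA divff ?pnatr_eq0// mul1r mulr_natl -lnXn ?sqrtr_gt0//.
  by rewrite sqr_sqrtr// ltW.
rewrite /log_ratio /stirling_ratio ln_div ?posrE ?ltr0n ?fact_gt0//.
rewrite lnM ?posrE ?sqrtr_gt0// ?exprn_gt0// lnXn// ln_div ?posrE ?expR_gt0//.
by rewrite expRK sqrtE -[_ *+ n.+1]mulr_natr; ring.
Qed.

Let log_ratioB n : log_ratio n - log_ratio n.+1 =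
  (n.+1%:R + 2^-1) * ln (n.+2%:R / n.+1%:R) - 1.
Proof.
rewrite !log_ratioE (factS n.+1) natrM lnM ?posrE ?ltr0n ?fact_gt0//.
rewrite ln_div ?posrE ?ltr0n// -(natr1 n.+1).
by set a := ln _; set b := ln _; set c := ln _; field.
Qed.

(* With t = (n + 2) / (n + 1), the midpoint bound on ln t is exactly
   1 / (n + 1 + 1/2). *)
Let log_ratio_noninc n : log_ratio n.+1 <= log_ratio n.
Proof.
rewrite -subr_ge0 log_ratioB subr_ge0.
set x : R := n.+1%:R; have x0 : 0 < x by rewrite ltr0n.
have -> : n.+2%:R = x + 1 :> R by rewrite -natr1.
have := @ln_ge_midpoint R ((x + 1) / x).
rewrite ler_pdivlMr// mul1r => /(_ ltac:(lra)).
have -> : 2 - 4 / (1 + (x + 1) / x) = (x + 2^-1)^-1.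
  by field; rewrite !gt_eqF//=; lra.
have y0 : 0 < x + 2^-1 by lra.
by move=> /(ler_wpM2l (ltW y0)); rewrite divff ?gt_eqF.
Qed.

(* The trapezoidal bound gives a decrement of at most
   1 / (4 (n + 1) (n + 2)), which telescopes; this bounds ln s(n) from below. *)
Let log_ratio_nondec n :
  log_ratio n - (4 * n.+1%:R)^-1 <= log_ratio n.+1 - (4 * n.+2%:R)^-1.
Proof.
rewrite -subr_ge0 (_ : _ - _ = (4 * n.+1%:R)^-1 - (4 * n.+2%:R)^-1
  - (log_ratio n - log_ratio n.+1)); last by ring.
rewrite log_ratioB subr_ge0.
set x : R := n.+1%:R; have x0 : 0 < x by rewrite ltr0n.
have -> : n.+2%:R = x + 1 :> R by rewrite -natr1.
have x10 : 0 < x + 1 by lra.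
have := @ln_le_trapezoid R ((x + 1) / x).
rewrite ler_pdivlMr// mul1r => /(_ ltac:(lra)).
have y0 : 0 < x + 2^-1 by lra.
move=> /(ler_wpM2l (ltW y0)); rewrite -(lerD2r (- 1)) => /le_trans; apply.
rewrite le_eqVlt; apply/orP; left; apply/eqP.
by field; rewrite !gt_eqF.
Qed.

Lemma stirling_ratio_is_cvg : exists2 L : R, 0 < L & stirling_ratio @ \oo --> L.
Proof.
have cvgl : cvgn log_ratio.
  apply: nonincreasing_is_cvgn; first exact/nonincreasing_seqP.
  exists (log_ratio 0 - (4 * 1%:R)^-1) => _ [n _ <-].
  apply: (@le_trans _ _ (log_ratio n - (4 * n.+1%:R)^-1)).
    elim: n => [//|n /le_trans]; apply; exact: log_ratio_nondec.
  by rewrite gerBl invr_ge0 mulr_ge0.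
exists (expR (limn log_ratio)); first exact: expR_gt0.
rewrite -cvg_shiftS.
have -> : (fun n => stirling_ratio n.+1) = expR \o log_ratio.
  by apply/funext => n /=; rewrite lnK// posrE stirling_ratio_gt0.
by apply: continuous_cvg => //; exact: continuous_expR.
Qed.

End Stirling.

Lemma cvgny_double : n.*2 @[n --> \oo] --> \oo.
Proof.
apply/cvgnyPge => m; near=> n; rewrite -addnn.
by apply: (leq_trans _ (leq_addr _ _)); near: n; exact: nbhs_infty_ge.
Unshelve. all: by end_near. Qed.

Section Wallis.
Variable R : realType.
Implicit Types (n : nat) (x : R).

(** The primitive of cos^n vanishing at 0, obtained by integrating by parts. The
    recursion replaces any integral in what follows. *)
Fixpoint cos_pow_primitive n x : R :=
  match n with
  | 0 => x
  | n'.+1 => match n' with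
    | 0 => sin x
    | m.+1 => m.+2%:R^-1 * (sin x * cos x ^+ m.+1)
              + m.+1%:R / m.+2%:R * cos_pow_primitive m x
    end
  end.

Lemma is_derive_cos_pow_primitive n x :
  is_derive x 1 (cos_pow_primitive n) (cos x ^+ n).
Proof.
suff [] : is_derive x 1 (cos_pow_primitive n) (cos x ^+ n) /\
  is_derive x 1 (cos_pow_primitive n.+1) (cos x ^+ n.+1) by [].
elim: n => [|n [IH0 IH1]]; split => //.
- by rewrite expr0; exact: is_derive_id.
- by rewrite expr1; exact: is_derive_sin.
have dX : is_derive x 1 (fun y : R => cos y ^+ n.+1)
    ((n.+1%:R * cos x ^+ n) *: - sin x).
  have -> : (fun y : R => cos y ^+ n.+1) = (@cos R) ^+ n.+1 by rewrite exprfctE.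
  exact: is_deriveX.
have dM : is_derive x 1 (fun y : R => sin y * cos y ^+ n.+1)
    (sin x *: ((n.+1%:R * cos x ^+ n) *: - sin x) + cos x ^+ n.+1 *: cos x).
  exact: is_deriveM.
have dZ : is_derive x 1 (fun y : R => n.+2%:R^-1 * (sin y * cos y ^+ n.+1))
    (n.+2%:R^-1 *:
      (sin x *: ((n.+1%:R * cos x ^+ n) *: - sin x) + cos x ^+ n.+1 *: cos x)).
  exact: is_deriveZ.
apply: (is_derive_eq (is_deriveD dZ (is_deriveZ (n.+1%:R / n.+2%:R) IH0))).
rewrite /GRing.scale/=.
have n2 : n.+2%:R != 0 :> R by rewrite pnatr_eq0.
have -> : sin x * (n.+1%:R * cos x ^+ n * - sin x) =
  - (n.+1%:R * cos x ^+ n * sin x ^+ 2) by ring.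
rewrite sin2cos2 !exprS; move: n2; rewrite -!natr1 => n2.
by field.
Qed.

(** The Wallis integral of cos^n over [0, pi/2]. *)
Definition wallis n : R := cos_pow_primitive n (pi / 2).

Lemma wallis0 : wallis 0 = pi / 2. Proof. by []. Qed.

Lemma wallis1 : wallis 1 = 1. Proof. exact: sin_pihalf. Qed.

Lemma wallisSS n : wallis n.+2 = n.+1%:R / n.+2%:R * wallis n.
Proof. by rewrite /wallis/= cos_pihalf expr0n/= !mulr0 add0r. Qed.

Lemma wallis_gt0 n : 0 < wallis n.
Proof.
suff [] : 0 < wallis n /\ 0 < wallis n.+1 by [].
elim: n => [|n [IH0 IH1]]; split => //.
- by rewrite wallis0 divr_gt0 ?pi_gt0.
- by rewrite wallis1.
- by rewrite wallisSS mulr_gt0// divr_gt0.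
Qed.

Lemma wallis_noninc n : wallis n.+1 <= wallis n.
Proof.
have p0 : 0 <= pi / 2 :> R by rewrite divr_ge0 ?pi_ge0.
have H0 m : cos_pow_primitive m 0 = 0.
  suff [] : cos_pow_primitive m 0 = 0 /\ cos_pow_primitive m.+1 0 = 0 by [].
  elim: m => [|m [IH0 IH1]]; split => //=; first exact: sin0.
  by rewrite sin0 IH0 mul0r !mulr0 addr0.
have := is_derive_ge0_le p0 (fun x _ => is_deriveB
  (is_derive_cos_pow_primitive n x) (is_derive_cos_pow_primitive n.+1 x)).
rewrite !fctE !H0 subrr subr_ge0; apply => x /andP[x0 xp].
have c0 : 0 <= cos x by rewrite cos_ge0_pihalf// xp andbT; lra.
by rewrite subr_ge0 exprS ler_piMl ?exprn_ge0 ?cos_le1.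
Qed.

(** The recursion W_(n+2) = (n + 1) / (n + 2) W_n makes (n + 1) W_(n+1) W_n
    independent of n. *)
Lemma wallis_mul n : n.+1%:R * (wallis n.+1 * wallis n) = pi / 2.
Proof.
elim: n => [|n IH]; first by rewrite wallis0 wallis1 !mul1r.
rewrite -IH wallisSS.
have n2 : n.+2%:R != 0 :> R by rewrite pnatr_eq0.
by field.
Qed.

Lemma wallis_double n :
  wallis n.*2 = pi / 2 * ((n.*2)`!%:R / (4 ^+ n * n`!%:R ^+ 2)).
Proof.
elim: n => [|n IH]; first by rewrite wallis0 /= expr0 fact0 expr1n mulr1 divr1 mulr1.
rewrite doubleS wallisSS IH !factS !natrM !exprMn (exprS _ n).
have f0 : n`!%:R != 0 :> R by rewrite pnatr_eq0 -lt0n fact_gt0.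
have g0 : 4 ^+ n != 0 :> R by rewrite expf_neq0 ?pnatr_eq0.
have -> : n.*2.+2%:R = 2 * (n%:R + 1) :> R.
  by rewrite -doubleS -mul2n natrM -(natr1 n).
have n1 : n%:R + 1 != 0 :> R by rewrite natr1 pnatr_eq0.
by rewrite -(natr1 n); field; rewrite n1 f0 g0.
Qed.

(** Since W is nonincreasing and W_(2n+2) / W_(2n) tends to 1, W_(2n+1) may be
    replaced by W_(2n) in (2n + 1) W_(2n+1) W_(2n) = pi / 2. *)
Lemma wallis_cvg : n.*2.+1%:R * wallis n.*2 ^+ 2 @[n --> \oo] --> (pi / 2 : R).
Proof.
apply: (@squeeze_cvgr _ _ _ _ (fun=> pi / 2)
    (fun n => pi / 2 * (1 + n.*2.+1%:R^-1))).
- near=> n; apply/andP; split.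
    rewrite -(wallis_mul n.*2) ler_pM2l ?ltr0n// expr2.
    by rewrite ler_pM2r ?wallis_gt0// wallis_noninc.
  rewrite -(wallis_mul n.*2).
  have := wallis_noninc n.*2.+1; rewrite wallisSS -(natr1 n.*2.+1).
  have := wallis_gt0 n.*2; have : 0 < n.*2.+1%:R :> R by rewrite ltr0n.
  move: (wallis _) (wallis _) (n.*2.+1%:R) => b a x x0 a0.
  have x10 : 0 < x + 1 by lra.
  rewrite mulrAC ler_pdivrMr// => h.
  rewrite (_ : x * _ * _ = a * (b * (x + 1))); last by field; rewrite gt_eqF.
  by rewrite expr2 mulrA mulrC ler_pM2l.
- exact: cvg_cst.
- suff : pi / 2 * (1 + n.*2.+1%:R^-1) @[n --> \oo] --> pi / 2 * (1 + 0 : R).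
    by rewrite addr0 mulr1.
  apply: cvgMl_tmp; apply: cvgD; first exact: cvg_cst.
  exact: (cvg_comp _ _ cvgny_double (@cvg_harmonic R)).
Unshelve. all: by end_near. Qed.

End Wallis.

Lemma factE_stirling_ratio (R : realType) (n : nat) : (0 < n)%N ->
  n`!%:R = stirling_ratio R n * (Num.sqrt n%:R * (n%:R / expR 1) ^+ n).
Proof.
move=> n0; rewrite /stirling_ratio mulfVK// gt_eqF//.
by rewrite mulr_gt0 ?sqrtr_gt0 ?ltr0n// exprn_gt0// divr_gt0 ?ltr0n ?expR_gt0.
Qed.

(** The limit L exists and is positive; by Stirling, W_(2n) is asymptotically
    (pi / 2) sqrt(2 / n) / L, so Wallis' limit reads pi^2 / L^2 = pi / 2. *)
Lemma stirling_ratio_cvg (R : realType) :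
  @stirling_ratio R @ \oo --> Num.sqrt (2 * pi).
Proof.
have [L L0 sL] := @stirling_ratio_is_cvg R.
suff -> : Num.sqrt (2 * pi) = L by [].
suff L2 : L ^+ 2 = 2 * pi by rewrite -L2 sqrtr_sqr ger0_norm// ltW.
pose s := stirling_ratio R.
pose g n : R := (pi / 2) ^+ 2 * ((s n.*2 / s n ^+ 2) ^+ 2 * (4 + 2 / n%:R)).
have gE : \forall n \near \oo, n.*2.+1%:R * wallis R n.*2 ^+ 2 = g n.
  near=> n; have n0 : (0 < n)%N by near: n; exact: nbhs_infty_gt.
  rewrite wallis_double !factE_stirling_ratio ?double_gt0// -/s /g.
  have := stirling_ratio_gt0 R n0; rewrite -/s.
  have -> : n.*2.+1%:R = 2 * n%:R + 1 :> R by rewrite -(natr1 n.*2) -mul2n natrM.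
  have -> : n.*2%:R = 2 * n%:R :> R by rewrite -mul2n natrM.
  have : 0 < n%:R :> R by rewrite ltr0n.
  move: (s n) (s n.*2) n%:R => a b x x0 a0.
  have y0 : 0 < (x / expR 1) ^+ n by rewrite exprn_gt0// divr_gt0 ?expR_gt0.
  have -> : (2 * x / expR 1) ^+ n.*2 = 4 ^+ n * ((x / expR 1) ^+ n) ^+ 2.
    have -> : 4 = 2 ^+ 2 :> R by ring.
    by rewrite -!exprM muln2 mul2n -mulrA exprMn.
  have : 4 ^+ n != 0 :> R by rewrite expf_neq0 ?pnatr_eq0.
  move: y0; move: (4 ^+ n) (_ ^+ n) => p y y0 p0.
  have u0 : 0 < Num.sqrt x by rewrite sqrtr_gt0.
  have u2 : Num.sqrt x ^+ 2 = x by rewrite sqr_sqrtr// ltW.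
  have v2 : Num.sqrt (2 * x) ^+ 2 = 2 * x by rewrite sqr_sqrtr// mulr_ge0// ltW.
  move: u0 u2 v2; move: (Num.sqrt (2 * x)) (Num.sqrt x) => v u u0 u2 v2.
  rewrite (_ : (_ * _) ^+ 2 =
    (pi / 2) ^+ 2 * (b ^+ 2 * v ^+ 2) / (a ^+ 4 * (u ^+ 2) ^+ 2)).
    by rewrite u2 v2; field; rewrite !gt_eqF.
  by field; rewrite p0 !gt_eqF.
have gL : g @ \oo --> (pi / 2) ^+ 2 * ((L / L ^+ 2) ^+ 2 * (4 + 2 * 0)).
  have s2L : s n.*2 @[n --> \oo] --> L := cvg_comp _ _ cvgny_double sL.
  have L20 : L ^+ 2 != 0 by rewrite gt_eqF// exprn_gt0.
  apply: cvgMl_tmp; apply: cvgM.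
    have h : s n.*2 / s n ^+ 2 @[n --> \oo] --> L / L ^+ 2.
      by apply: cvgM => //; apply: cvgV => //; rewrite expr2; exact: cvgM.
    by rewrite expr2; exact: (cvgM h h).
  apply: cvgD; first exact: cvg_cst.
  by apply: cvgMl_tmp; rewrite -cvg_shiftS; exact: cvg_harmonic.
have gpi : g @ \oo --> (pi / 2 : R).
  exact: cvg_trans (near_eq_cvg gE) (@wallis_cvg R).
have /eqP : (pi / 2) ^+ 2 * ((L / L ^+ 2) ^+ 2 * (4 + 2 * 0)) = pi / 2.
  exact: cvg_unique gL gpi.
have pi0 : 0 < pi :> R := pi_gt0 R.
have -> : (pi / 2) ^+ 2 * ((L / L ^+ 2) ^+ 2 * (4 + 2 * 0)) = pi ^+ 2 / L ^+ 2.
  by field; rewrite gt_eqF.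
have L20 : L ^+ 2 != 0 by rewrite gt_eqF// exprn_gt0.
rewrite eqr_div// => /eqP h.
by apply: (mulfI (lt0r_neq0 pi0)); rewrite -h; ring.
Unshelve. all: by end_near. Qed.

(** Squeeze with y = x / n in exp(y / (1 + y)) <= 1 + y <= exp y; both bounds are
    instances of 1 + z <= exp z. *)
Lemma cvg_expn_expR (R : realType) (x : R) :
  (1 + x / n%:R) ^+ n @[n --> \oo] --> expR x.
Proof.
have hxn : (x / n%:R) @[n --> \oo] --> (0 : R).
  rewrite -[X in _ --> X](mulr0 x).
  by apply: cvgMl_tmp; rewrite -cvg_shiftS; exact: cvg_harmonic.
have h1 : 1 + x / n%:R @[n --> \oo] --> (1 + 0 : R).
  by apply: cvgD => //; exact: cvg_cst.
apply: (@squeeze_cvgr _ _ _ _ (fun n => expR (x / (1 + x / n%:R))) (cst (expR x))).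
- near=> n.
  have n0 : (0 < n)%N by near: n; exact: nbhs_infty_gt.
  have x0 : 0 < n%:R :> R by rewrite ltr0n.
  have y0 : 0 < 1 + x / n%:R.
    by near: n; apply: (cvgr_gt (1 + 0)) => //; lra.
  apply/andP; split; last first.
    rewrite /cst -[in leRHS](mulfVK (lt0r_neq0 x0) x) expRM_natr.
    by rewrite lerXn2r ?nnegrE ?(ltW y0) ?expR_ge0 ?expR_ge1Dx.
  set y := 1 + x / n%:R; rewrite -/y in y0.
  have -> : x / y = (x / n%:R / y) * n%:R by field; rewrite !gt_eqF.
  rewrite expRM_natr lerXn2r ?nnegrE ?(ltW y0) ?expR_ge0//.
  rewrite -lef_pV2 ?posrE ?expR_gt0// -expRN.
  apply: le_trans (expR_ge1Dx _).
  rewrite le_eqVlt; apply/orP; left; apply/eqP.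
  by move: y0; rewrite /y; move: (x / n%:R) => z z0; field; rewrite gt_eqF.
- apply: continuous_cvg; first exact: continuous_expR.
  rewrite -[X in _ --> X]divr1 -[X in _ / X](addr0 1).
  apply: cvgMl_tmp; apply: cvgV => //; by rewrite addr0 oner_neq0.
- exact: cvg_cst.
Unshelve. all: by end_near. Qed.

(** * Abel's binomial identity *)

Section Abel.
Variable R : comNzRingType.
Implicit Types (x y : R) (n m d : nat).

(** The m-th iterated difference kills polynomials of degree less than m, as
    one difference lowers the degree by one. *)
Lemma iterated_difference_expn m d x : (d < m)%N ->
  \sum_(j < m.+1) (-1) ^+ j * 'C(m, j)%:R * (x + j%:R) ^+ d = 0.
Proof.
elim: m d => [//|m IH] d dm.
have -> : \sum_(j < m.+2) (-1) ^+ j * 'C(m.+1, j)%:R * (x + j%:R) ^+ d =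
    - \sum_(j < m.+1) (-1) ^+ j * 'C(m, j)%:R *
        ((x + j%:R + 1) ^+ d - (x + j%:R) ^+ d).
  have E (j : 'I_m.+1) : (-1) ^+ j.+1 * 'C(m.+1, j.+1)%:R * (x + j.+1%:R) ^+ d =
      (-1) ^+ j.+1 * 'C(m, j.+1)%:R * (x + j.+1%:R) ^+ d
      - (-1) ^+ j * 'C(m, j)%:R * (x + j%:R + 1) ^+ d.
    by rewrite binS natrD exprS -natr1 addrA; move: ((x + _ + 1) ^+ d) => z; ring.
  rewrite big_ord_recl; under eq_bigr => j _ do rewrite lift0 E.
  rewrite sumrB addrA.
  have -> : (-1) ^+ (@ord0 m.+1) * 'C(m.+1, @ord0 m.+1)%:R * (x + (@ord0 m.+1)%:R) ^+ d +
      \sum_(j < m.+1) (-1) ^+ j.+1 * 'C(m, j.+1)%:R * (x + j.+1%:R) ^+ d =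
      \sum_(j < m.+1) (-1) ^+ j * 'C(m, j)%:R * (x + j%:R) ^+ d.
    rewrite [RHS]big_ord_recl big_ord_recr/= (bin_small (ltnSn m)).
    by rewrite !bin0 mulr0n mulr0 mul0r !addr0.
  by rewrite -sumrB -sumrN; apply: eq_bigr => j _; rewrite mulrBr opprB.
have dE (z : R) : (z + 1) ^+ d - z ^+ d = \sum_(e < d) 'C(d, e)%:R * z ^+ e.
  rewrite [z + 1]addrC exprDn big_ord_recr/= subnn expr0 mul1r binn mulr1n addrK.
  by apply: eq_bigr => e _; rewrite expr1n mul1r mulr_natl.
under eq_bigr => j _ do rewrite dE mulr_sumr.
rewrite exchange_big/= big1 ?oppr0// => e _.
under eq_bigr => j _ do rewrite mulrCA.
by rewrite -mulr_sumr IH ?mulr0// (leq_trans (ltn_ord e)).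
Qed.

(** The Abel polynomial x (x + j)^(j-1); the case distinction avoids the exponent
    -1 at j = 0, where the value is x / x = 1. *)
Definition abel_coef j x : R := if j is i.+1 then x * (x + j%:R) ^+ i else 1.

Lemma abel_coefM j m x : (j <= m)%N -> (0 < m)%N ->
  abel_coef j x * (x + j%:R) ^+ (m - j) = x * (x + j%:R) ^+ m.-1.
Proof.
case: j m => [|i] [//|m] /= im _; first by rewrite subn0 mul1r addr0 exprS.
by rewrite subSS -mulrA -exprD subnKC.
Qed.

(** Expand (y - j)^(n-j) in powers of x + y = (y - j) + (x + j): the coefficient
    of (x + y)^i is x times an iterated difference of order n - i of the
    polynomial (x + j)^(n-i-1) in j, so that only i = n remains. *)
Theorem abel_identity n x y :
  \sum_(j < n.+1) 'C(n, j)%:R * abel_coef j x * (y - j%:R) ^+ (n - j)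
  = (x + y) ^+ n.
Proof.
have step (j : 'I_n.+1) :
    'C(n, j)%:R * abel_coef j x * (y - j%:R) ^+ (n - j) =
    \sum_(i < n.+1) (x + y) ^+ i * ('C(n, i)%:R * ((-1) ^+ (n - i) *
      ((-1) ^+ j * 'C(n - i, j)%:R * (abel_coef j x * (x + j%:R) ^+ (n - i - j))))).
  have -> : y - j%:R = - (x + j%:R) + (x + y) by ring.
  rewrite exprDn mulr_sumr.
  have jn : ((n - j).+1 <= n.+1)%N by rewrite ltnS leq_subr.
  rewrite (big_ord_widen _ (fun i => 'C(n, j)%:R * abel_coef j x *
     ((- (x + j%:R)) ^+ (n - j - i) * (x + y) ^+ i *+ 'C(n - j, i))) jn).
  rewrite big_mkcond/=; apply: eq_bigr => i _.
  (* 'C(n, j) 'C(n - j, i) = 'C(n, i) 'C(n - i, j), both sides being 0 when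
     i + j > n *)
  case: ltnP => ij; last first.
    have nij : (n - i < j)%N by have := ltn_ord i; have := ltn_ord j; lia.
    by rewrite (bin_small nij) mulr0n !(mulr0, mul0r).
  have := ltn_ord i; have := ltn_ord j; rewrite !ltnS => jn' in_.
  have -> : (- (x + j%:R)) ^+ (n - j - i) =
      (-1) ^+ (n - i) * (-1) ^+ j * (x + j%:R) ^+ (n - i - j).
    rewrite -[- _]mulN1r exprMn (_ : n - j - i = n - i - j)%N; last lia.
    congr (_ * _); rewrite -exprD.
    have -> : (n - i + j = n - i - j + 2 * j)%N by lia.
    by rewrite exprD exprM sqrrN !expr1n mulr1.
  have binE : ('C(n, j) * 'C(n - j, i) = 'C(n, i) * 'C(n - i, j))%N.
    apply/eqP; rewrite -(eqn_pmul2r (fact_gt0 (n - j - i))).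
    rewrite -(eqn_pmul2r (fact_gt0 i)) -(eqn_pmul2r (fact_gt0 j)); apply/eqP.
    have h1 := @bin_fact n j jn'; have h2 := @bin_fact n i in_.
    have h3 := @bin_fact (n - j) i ltac:(lia).
    have h4 := @bin_fact (n - i) j ltac:(lia).
    have e : (n - j - i = n - i - j)%N by lia.
    rewrite e in h3 *.
    transitivity ('C(n, j) * (j`! * ('C(n - j, i) * (i`! * (n - i - j)`!))))%N.
      by ring.
    rewrite h3 h1 -h2 -h4; ring.
  rewrite -mulr_natr.
  transitivity (abel_coef j x * (x + j%:R) ^+ (n - i - j) * (-1) ^+ (n - i) *
    (-1) ^+ j * (x + y) ^+ i * ('C(n, j) * 'C(n - j, i))%:R).
    by rewrite natrM; ring.
  by rewrite binE natrM; ring.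
rewrite (eq_bigr _ (fun j _ => step j)) exchange_big/= big_ord_recr/=.
rewrite big1 ?add0r => [|i _].
  rewrite subnn binn big_ord_recl big1 => [|j _]; last by rewrite bin_small//; ring.
  by rewrite bin0/=; ring.
rewrite -!mulr_sumr; set S := \sum_(_ < _) _; suff -> : S = 0 by ring.
have i0 : (0 < n - i)%N by rewrite subn_gt0.
have ni : ((n - i).+1 <= n.+1)%N by rewrite ltnS leq_subr.
rewrite -[RHS](mulr0 x) -(iterated_difference_expn x (_ : (n - i).-1 < n - i)%N);
  last by rewrite prednK.
rewrite (big_ord_widen _ (fun j => (-1) ^+ j * 'C(n - i, j)%:R *
  (x + j%:R) ^+ (n - i).-1) ni) big_mkcond mulr_sumr; apply: eq_bigr => j _.
rewrite ltnS; case: leqP => [jni|nij]; last by rewrite bin_small// mulr0n !(mulr0, mul0r).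
by rewrite abel_coefM// mulrCA.
Qed.

End Abel.

(** * Cascades on a finite set of lines *)

Section Cascade.
Variable I : finType.
Implicit Types (f : I -> nat) (S J : {set I}) (i k : nat).

(** Line j lies in cell f j when its capacity is above exactly f j of the levels
    l(1) <= l(2) <= ..., so that it is at most l(i) iff f j < i. With the shift
    i := i - 1 this is the order statistics condition for the lines of S. *)
Definition cascade f S : bool :=
  [forall i : 'I_#|S|, i < #|[set j in S | f j <= i]|]%N.

(** The cascade among the lines of S stops with J as set of failed lines. *)
Definition halts f S J : bool :=
  [&& J \subset S, cascade f J & [forall j in S :\: J, #|J| < f j]%N].

Lemma cascadeP f S :
  reflect (forall i, (i < #|S|)%N -> (i < #|[set j in S | (f j <= i)%N]|)%N)
          (cascade f S).
Proof.
apply: (iffP forallP) => [h i iS|h [i iS]]; last exact: h.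
exact: (h (Ordinal iS)).
Qed.

Lemma cascadeE f g S : {in S, f =1 g} -> cascade f S = cascade g S.
Proof.
move=> fg; apply: eq_forallb => i; congr (_ < #|pred_of_set _|)%N.
by apply/setP => j; rewrite !inE; case: (boolP (j \in S)) => // /fg ->.
Qed.

Lemma cascade_lt f S : cascade f S -> {in S, forall j, (f j < #|S|)%N}.
Proof.
move=> /cascadeP h j jS.
have S0 : (0 < #|S|)%N by apply/card_gt0P; exists j.
have {}h := h #|S|.-1; rewrite prednK// in h; have {}h := h (leqnn _).
have /eqP SE : [set j in S | (f j <= #|S|.-1)%N] == S.
  by rewrite eqEcard h andbT; apply/fintype.subsetP => x; rewrite inE => /andP[].
by move: jS; rewrite -{1}SE inE => /andP[_]; rewrite -ltnS prednK.
Qed.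

Lemma halts_setE f S J : halts f S J -> J = [set j in S | (f j < #|J|)%N].
Proof.
move=> /and3P[JS /cascade_lt Jlt /forall_inP h]; apply/setP => j; rewrite inE.
apply/idP/andP => [jJ|[jS fj]]; first by rewrite (fintype.subsetP JS)// Jlt.
by apply: contraLR fj => jJ; rewrite -leqNgt ltnW// h// inE jJ.
Qed.

(** If #|J| < #|J'|, then the cascade on J' needs more than #|J| lines in cells
    up to #|J|, while all such lines of S lie in J. *)
Lemma halts_card_le f S J J' : halts f S J -> halts f S J' -> (#|J'| <= #|J|)%N.
Proof.
move=> /and3P[_ _ /forall_inP h] /and3P[J'S /cascadeP h' _].
rewrite leqNgt; apply/negP => /[dup] JJ' /h'; apply/negP; rewrite -leqNgt.
apply/subset_leq_card/fintype.subsetP => j; rewrite inE => /andP[jJ'].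
by apply: contraTT => jJ; rewrite -ltnNge h// inE jJ (fintype.subsetP J'S).
Qed.

Lemma halts_uniq f S J J' : halts f S J -> halts f S J' -> J = J'.
Proof.
move=> h h'; rewrite (halts_setE h) [RHS](halts_setE h').
have -> // : #|J| = #|J'|.
by apply/eqP; rewrite eqn_leq !(halts_card_le h' h, halts_card_le h h').
Qed.

(** The cascade stops at the least k such that at most k lines of S lie in the
    cells 0, ..., k; then exactly k lie in the cells below k, and none in cell k. *)
Lemma halts_exists f S : exists J, halts f S J.
Proof.
pose c k := #|[set j in S | (f j <= k)%N]|.
have ex : exists k, (c k <= k)%N.
  by exists #|S|; apply/subset_leq_card/fintype.subsetP => j; rewrite inE => /andP[].
pose k := ex_minn ex.
have [ck kmin] : (c k <= k)%N /\ forall i, (i < k)%N -> (i < c i)%N.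
  rewrite /k; case: ex_minnP => m cm mmin; split => // i im.
  by rewrite ltnNge; apply/negP => /mmin; rewrite leqNgt im.
pose J := [set j in S | (f j < k)%N].
have JcE i : (i < k)%N -> [set j in J | (f j <= i)%N] = [set j in S | (f j <= i)%N].
  move=> ik; apply/setP => j; rewrite !inE -andbA; case: (j \in S) => //=.
  by apply/andb_idl => /leq_ltn_trans; apply.
have JS : J \subset [set j in S | (f j <= k)%N].
  by apply/fintype.subsetP => j; rewrite !inE => /andP[-> /ltnW].
have Jk : #|J| = k.
  apply/eqP; rewrite eqn_leq (leq_trans (subset_leq_card JS))//=.
  case: (posnP k) => [->//|k0]; have pk : (k.-1 < k)%N by rewrite prednK.
  have := kmin _ pk; rewrite prednK// => /leq_trans; apply.
  rewrite /c -JcE// subset_leq_card//.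
  by apply/fintype.subsetP => j; rewrite inE => /andP[].
exists J; apply/and3P; split.
- by apply/fintype.subsetP => j; rewrite inE => /andP[].
- by apply/cascadeP => i; rewrite Jk => ik; rewrite JcE//; exact: kmin.
- have JE : J = [set j in S | (f j <= k)%N] by apply/eqP; rewrite eqEcard JS Jk.
  apply/forall_inP => j; rewrite inE Jk => /andP[jJ jS].
  by rewrite ltnNge; apply: contra jJ => fj; rewrite JE inE jS.
Qed.

Lemma sum_halts f S : (\sum_(J : {set I} | J \subset S) halts f S J)%N = 1%N.
Proof.
have [J hJ] := halts_exists f S; have JS : J \subset S by case/and3P: hJ.
rewrite (bigD1 J)//= hJ big1 ?addn0// => J' /andP[_ J'J].
by apply/eqP; rewrite eqb0; apply: contra J'J => /(halts_uniq hJ) ->.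
Qed.

End Cascade.

Lemma sum_subset_card (R : nmodType) (I : finType) (S : {set I}) (F : nat -> R) :
  \sum_(J : {set I} | J \subset S) F #|J| =
  \sum_(j < #|S|.+1) F j *+ 'C(#|S|, j).
Proof.
rewrite (partition_big (fun J : {set I} => inord #|J| : 'I_#|S|.+1) xpredT)//=.
apply: eq_bigr => j _.
rewrite -cards_draws -sumr_const; apply: eq_big => [J|J /andP[JS]].
  rewrite inE; case: (boolP (J \subset S)) => //= JS.
  by rewrite -val_eqE/= inordK// ltnS subset_leq_card.
by rewrite -val_eqE/= inordK ?ltnS ?subset_leq_card// => /eqP ->.
Qed.

(** * Weights of cascades under a product measure *)

Section ProductWeights.
Variables (R : comNzRingType) (I K : finType) (q : K -> R).
Hypothesis q1 : \sum_m q m = 1.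
Implicit Types (f g : {ffun I -> K}) (E F : pred {ffun I -> K}) (A : {set I}).

Definition prod_weight E : R := \sum_(f | E f) \prod_j q (f j).

Lemma prod_weight_cylinder (Q : I -> pred K) :
  prod_weight (fun f => [forall j, Q j (f j)]) = \prod_j \sum_(m | Q j m) q m.
Proof.
rewrite bigA_distr_big_dep; apply: eq_bigl => f.
exact/forallP/familyP.
Qed.

Lemma prod_weightT : prod_weight xpredT = 1.
Proof.
transitivity (\prod_(j : I) \sum_(m | xpredT m) q m); last by rewrite big1.
rewrite -prod_weight_cylinder; apply: eq_bigl => f; exact/esym/forallP.
Qed.

(** Independence over disjoint sets of coordinates: on pairs of configurations,
    exchanging the coordinates in A is an involution that preserves the product
    weight, and it turns E f, F g into E f, F f. *)
Lemma prod_weight_indep A E F :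
  (forall f g, {in ~: A, f =1 g} -> E f = E g) ->
  (forall f g, {in A, f =1 g} -> F f = F g) ->
  prod_weight (predI E F) = prod_weight E * prod_weight F.
Proof.
move=> EA FA; rewrite -[LHS]mulr1 -prod_weightT /prod_weight !big_distrlr/=.
rewrite !pair_big/=.
pose mix f g : {ffun I -> K} := [ffun j => if j \in A then g j else f j].
pose swap (p : {ffun I -> K} * {ffun I -> K}) := (mix p.1 p.2, mix p.2 p.1).
have swapK : involutive swap.
  move=> [f g]; congr pair; apply/ffunP => j; rewrite !ffunE /=;
    by case: ifP => // ->.
rewrite [RHS](reindex_inj (inv_inj swapK))/=.
apply: eq_big => [[f g]|[f g] _]/=.
  rewrite andbT; congr (_ && _).
    by apply: EA => j; rewrite inE ffunE => /negbTE ->.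
  by apply: FA => j jA; rewrite ffunE jA.
rewrite -!big_split/=; apply: eq_bigr => j _; rewrite !ffunE.
by case: ifP => // _; rewrite mulrC.
Qed.

End ProductWeights.

Section CascadeWeight.
Variables (R : comNzRingType) (I : finType) (K : nat) (q : 'I_K -> R).
Hypothesis q1 : \sum_m q m = 1.
Implicit Types (f : {ffun I -> 'I_K}) (S J : {set I}).

Local Notation cells f := (fun j => nat_of_ord (f j)).

Definition tail_weight k : R := \sum_(m : 'I_K | (k < m)%N) q m.

Definition cascade_weight S : R := prod_weight q (fun f => cascade (cells f) S).

Lemma prod_weight_halts S J : J \subset S ->
  prod_weight q (fun f => halts (cells f) S J) =
  cascade_weight J * tail_weight #|J| ^+ (#|S| - #|J|).
Proof.
move=> JS; pose A := S :\: J.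
have -> : tail_weight #|J| ^+ (#|S| - #|J|) =
    prod_weight q (fun f => [forall j in A, (#|J| < cells f j)%N]).
  rewrite (prod_weight_cylinder q (fun j (m : 'I_K) => (j \in A) ==> (#|J| < m)%N)).
  rewrite (bigID (mem A))/= [X in _ * X]big1 => [|j /negbTE jA]; last first.
    by rewrite -[RHS]q1; apply: eq_bigl => m; rewrite jA.
  rewrite mulr1 (eq_bigr (fun=> tail_weight #|J|)); last first.
    by move=> j jA; apply: eq_bigl => m; rewrite jA.
  by rewrite prodr_const cardsDS.
rewrite -(prod_weight_indep q1 (A := A)).
- by apply: eq_bigl => f; rewrite /halts JS.
- move=> f g fg; apply: cascadeE => j jJ; congr nat_of_ord; apply: fg.
  by rewrite !inE jJ.
- by move=> f g fg; apply: eq_forallb_in => j jA; rewrite fg.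
Qed.

Lemma sum_prod_weight_halts S :
  \sum_(J : {set I} | J \subset S) cascade_weight J * tail_weight #|J| ^+ (#|S| - #|J|)
  = 1.
Proof.
rewrite -(prod_weightT I q1) /prod_weight.
rewrite (eq_bigr (fun J => \sum_(f : {ffun I -> 'I_K})
  \prod_j q (f j) * (halts (cells f) S J)%:R)).
  rewrite exchange_big/=; apply: eq_bigr => f _.
  by rewrite -mulr_sumr -natr_sum sum_halts mulr1.
move=> J JS; rewrite -prod_weight_halts// /prod_weight big_mkcond/=.
by apply: eq_bigr => f _; case: (halts _ _ _); rewrite ?mulr1 ?mulr0.
Qed.

(** The relation sum_prod_weight_halts and Abel's identity at y = c - x are the
    same recursion in #|S|, each expressing its last term J = S through the
    smaller sets. *)
Lemma cascade_weightE (c x : R) (n : nat) S :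
  (forall k, (k < n)%N -> c * tail_weight k = c - x - k%:R) ->
  (#|S| <= n)%N -> c ^+ #|S| * cascade_weight S = abel_coef #|S| x.
Proof.
move=> tailE; move: {2}#|S|.+1 (ltnSn #|S|) => s.
elim: s S => [//|s IH] S Ss Sn.
have /(congr1 (fun z => c ^+ #|S| * z)) := sum_prod_weight_halts S.
rewrite mulr1 mulr_sumr => cS.
have abS := abel_identity #|S| x (c - x).
rewrite [x + (c - x)]addrC subrK -cS in abS.
pose F j : R := abel_coef j x * (c - x - j%:R) ^+ (#|S| - j).
have {abS} : \sum_(J : {set I} | J \subset S) F #|J| =
    \sum_(J : {set I} | J \subset S)
      c ^+ #|S| * (cascade_weight J * tail_weight #|J| ^+ (#|S| - #|J|)).
  rewrite -abS sum_subset_card; apply: eq_bigr => j _.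
  by rewrite -mulrA mulr_natl.
rewrite (bigD1 S)//= [RHS](bigD1 S)//= {1}/F subnn !expr0 !mulr1.
set s1 := \sum_(_ | _) _; set s2 := \sum_(_ | _) _.
suff -> : s1 = s2 by move/addIr.
apply: eq_bigr => J /andP[JS JneS].
have JltS : (#|J| < #|S|)%N by rewrite proper_card// finset.properEneq JneS.
have JleS := ltnW JltS.
rewrite /F -(IH J) ?(leq_trans JltS)//; last exact: leq_trans JleS Sn.
rewrite -tailE ?(leq_trans JltS)// exprMn.
have -> : c ^+ #|S| = c ^+ #|J| * c ^+ (#|S| - #|J|) by rewrite -exprD subnKC.
ring.
Qed.

(** Sets J at which the cascade halts are unique, so the probabilities for the
    'C(#|I|, k) sets of size k add up. *)
Lemma prod_weight_halts_card (c x : R) (n k : nat) :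
  (forall i, (i < n)%N -> c * tail_weight i = c - x - i%:R) ->
  (k < n)%N -> (k <= #|I|)%N ->
  c ^+ #|I| * prod_weight q (fun f =>
    [exists J : {set I}, halts (cells f) [set: I] J && (#|J| == k)])
  = 'C(#|I|, k)%:R * abel_coef k x * (c - x - k%:R) ^+ (#|I| - k).
Proof.
move=> tailE kn kI.
have -> : prod_weight q (fun f =>
    [exists J : {set I}, halts (cells f) [set: I] J && (#|J| == k)]) =
   \sum_(J : {set I} | #|J| == k) prod_weight q (fun f => halts (cells f) [set: I] J).
  rewrite /prod_weight big_mkcond/= (eq_bigr (fun f =>
     \sum_(J : {set I} | #|J| == k) (halts (cells f) [set: I] J)%:R * \prod_j q (f j))).
    rewrite exchange_big/=; apply: eq_bigr => J _.
    rewrite [RHS]big_mkcond/=; apply: eq_bigr => f _.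
    by case: (halts _ _ _); rewrite ?mul1r ?mul0r.
  move=> f _; rewrite -mulr_suml; case: existsP => [[J /andP[hJ Jk]]|nJ].
    rewrite (bigD1 J)//= hJ [X in _ + X]big1 ?addr0 ?mul1r// => J' /andP[_ J'J].
    by case: (boolP (halts _ _ J')) => // /(halts_uniq hJ) JJ'; rewrite JJ' eqxx in J'J.
  rewrite [X in X * _]big1 ?mul0r// => J Jk; case: (boolP (halts _ _ _)) => // hJ.
  by case: nJ; exists J; rewrite hJ Jk.
rewrite mulr_sumr (eq_bigr (fun=> abel_coef k x * (c - x - k%:R) ^+ (#|I| - k))).
  rewrite sumr_const -[LHS]mulr_natl mulrA.
  rewrite -[#|I|]cardsT -cards_draws; congr (_%:R * _ * _).
  by apply: eq_card => J; rewrite !inE finset.subsetT.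
move=> J /eqP Jk; rewrite prod_weight_halts ?finset.subsetT// cardsT -tailE// exprMn.
have Jn : (#|J| <= n)%N by rewrite Jk ltnW.
rewrite -{1}Jk -(cascade_weightE tailE Jn) Jk.
have -> : c ^+ #|I| = c ^+ k * c ^+ (#|I| - k) by rewrite -exprD subnKC.
ring.
Qed.

End CascadeWeight.

(** * The blackout size as a cascade of cells *)

Lemma nth_sort_le (R : realDomainType) (s : seq R) (x : R) i : (i < size s)%N ->
  (nth 0 (sort <=%R s) i <= x) = (i < count (fun y : R => (y <= x)%R) s)%N.
Proof.
move=> iS; have := sort_le_sorted s.
rewrite -(permP (permEl (perm_sort <=%R s))) -(size_sort <=%R) in iS *.
move: (sort _ s) iS => {}s iS ss.
apply/idP/idP => [six|]; last (apply: contraLR; rewrite -ltNge -leqNgt => xs).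
- rewrite -[s](cat_take_drop i.+1) count_cat (leq_trans _ (leq_addr _ _))//.
  rewrite (_ : count _ (take i.+1 s) = i.+1)//.
  rewrite -[RHS](size_takel (_ : i.+1 <= size s)%N)//; apply/eqP; rewrite -all_count.
  apply/(all_nthP 0) => k; rewrite size_takel// => ki; rewrite nth_take//.
  apply: le_trans six; apply: (le_sorted_leq_nth 0 ss); rewrite ?inE//.
  by rewrite (leq_ltn_trans _ iS).
- rewrite -[s](cat_take_drop i) count_cat (_ : count _ (drop i s) = 0%N).
    by rewrite addn0 (leq_trans (count_size _ _))// size_take; case: ifP => //; lia.
  apply/eqP; rewrite -leqn0 leqNgt -has_count; apply/(has_nthP 0) => -[k].
  rewrite size_drop => ki; rewrite nth_drop => skx.
  move: xs; rewrite ltNge => /negP; apply.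
  apply: le_trans skx; apply: (le_sorted_leq_nth 0 ss); rewrite ?inE ?leq_addr//.
  by rewrite -ltn_subRL.
Qed.

Section Cells.
Variables (R : realType) (N : nat) (l : nat -> R).
Hypothesis l_incr : forall i j : nat,
  (1 <= i)%N -> (i <= j)%N -> (j <= N)%N -> l i <= l j.

(** Counting the levels below x, rather than searching for the first one above,
    makes each cell an element of 'I_N.+1 without any hypothesis on l. *)
Definition cell_nat (x : R) : nat := count (fun i => l i < x) (iota 1 N).

Lemma cell_nat_lt x : (cell_nat x < N.+1)%N.
Proof. by rewrite ltnS -[leqRHS](size_iota 1) count_size. Qed.

Definition cell (x : R) : 'I_N.+1 := Ordinal (cell_nat_lt x).

Lemma cell_ltE x i : (1 <= i)%N -> (i <= N)%N -> (cell x < i)%N = (x <= l i).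
Proof.
move=> i1 iN; rewrite /cell/= /cell_nat.
have -> : iota 1 N = iota 1 i.-1 ++ iota i (N - i.-1).
  by rewrite -{2}[i](_ : 1 + i.-1 = i)%N -?iotaD; [congr iota; lia | lia].
rewrite count_cat; case: leP => [xi|ix].
  rewrite (_ : count _ (iota i _) = 0%N).
    by rewrite addn0 (leq_ltn_trans (count_size _ _))// size_iota prednK.
  apply/eqP; rewrite -leqn0 leqNgt -has_count; apply/hasPn => k.
  rewrite mem_iota => /andP[ik kN]; rewrite -leNgt (le_trans xi)//.
  by apply: l_incr => //; lia.
apply/negbTE; rewrite -leqNgt (_ : (N - i.-1 = (N - i).+1)%N); last lia.
rewrite /= ix (_ : count _ (iota 1 _) = i.-1)%N; first lia.
rewrite -[RHS](size_iota 1 i.-1); apply/eqP; rewrite -all_count.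
apply/allP => k; rewrite mem_iota => /andP[k1 ki]; apply: le_lt_trans ix.
by apply: l_incr => //; lia.
Qed.

Lemma order_stat_leE (c : 'I_N -> R) i : (1 <= i)%N -> (i <= N)%N ->
  (order_stat c i <= l i) = (i <= #|[set j | (cell (c j) < i)%N]%SET|)%N.
Proof.
move=> i1 iN; rewrite /order_stat nth_sort_le; last first.
  by rewrite size_codom card_ord prednK.
rewrite prednK// /codom count_map enumT; congr (_ <= _)%N.
rewrite cardsE cardE size_filter; apply: eq_count => j /=.
by rewrite -(cell_ltE (c j) i1 iN).
Qed.

Lemma blackout_size_halts (c : 'I_N -> R) (J : {set 'I_N}) :
  halts (fun j => cell (c j)) [set: 'I_N] J -> blackout_size l c = #|J|.
Proof.
move=> hJ; have JE := halts_setE hJ.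
have JN : (#|J| <= N)%N by rewrite -[leqRHS]card_ord max_card.
have good i : (1 <= i)%N -> (i <= #|J|)%N -> order_stat c i <= l i.
  move=> i1 iJ; rewrite (order_stat_leE _ i1 (leq_trans iJ JN)).
  have /and3P[_ /cascadeP /(_ i.-1) h _] := hJ; rewrite prednK// in h.
  apply: (leq_trans (h iJ)); apply/subset_leq_card/fintype.subsetP => j.
  by rewrite !inE => /andP[_]; rewrite -ltnS prednK.
have bad : (#|J| < N)%N -> ~~ (order_stat c #|J|.+1 <= l #|J|.+1).
  move=> JltN; rewrite order_stat_leE// -ltnNge ltnS subset_leq_card//.
  apply/fintype.subsetP => j; rewrite inE; apply: contraTT => jJ.
  have /and3P[_ _ /forall_inP/(_ j)] := hJ.
  by rewrite !inE jJ => /(_ isT); rewrite ltnS -ltnNge.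
rewrite /blackout_size; apply/eqP; rewrite eqn_leq; apply/andP; split.
  apply/bigmax_leqP_seq => k; rewrite mem_index_iota => /andP[k1 kN] /allP h.
  rewrite leqNgt; apply/negP => Jk; have /bad/negP : (#|J| < N)%N by lia.
  by apply; apply: h; rewrite mem_iota; lia.
have [->//|J0] := posnP #|J|.
apply: (@leq_bigmax_seq _ _ _ id); first by rewrite mem_index_iota J0 ltnS.
by apply/allP => i; rewrite mem_iota => /andP[i1 iJ]; apply: good.
Qed.

Lemma blackout_sizeE (c : 'I_N -> R) (k : nat) :
  (blackout_size l c = k) <->
  [exists J : {set 'I_N}, halts (fun j => cell (c j)) [set: 'I_N] J && (#|J| == k)].
Proof.
split=> [bk|/existsP[J /andP[hJ /eqP <-]]]; last exact: blackout_size_halts.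
have [J hJ] := halts_exists (fun j => cell (c j)) [set: 'I_N].
by apply/existsP; exists J; rewrite hJ -bk (blackout_size_halts hJ) eqxx.
Qed.

End Cells.

(** * The law of the blackout size *)

Section BlackoutProbability.
Context (d : measure_display) (T : measurableType d) (R : realType)
  (P : probability T R) (N : nat).
Variables (C : 'I_N -> {RV P >-> R}) (F : R -> R) (l : nat -> R).
Hypothesis indepC : mutually_independent C.
Hypothesis cdfC : forall j r, cdf (C j) r = (F r)%:E.
Hypothesis l_incr : forall i j : nat,
  (1 <= i)%N -> (i <= j)%N -> (j <= N)%N -> l i <= l j.

(* The distribution function along the levels, completed by l(0) = -oo and
   l(N + 1) = +oo. *)
Let cdf_level i : R :=
  if i is 0 then 0 else if (i <= N)%N then F (l i) else 1.

Definition cell_prob (m : 'I_N.+1) : R := cdf_level m.+1 - cdf_level m.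

Let below i : set R := [set x | (cell N l x < i)%N].

Let belowE i : below i =
  if i is 0 then set0 else if (i <= N)%N then `]-oo, l i]%classic else setT.
Proof.
apply/seteqP; case: i => [|i]; first by split => x.
case: ifP => [iN|/negbT]; last first.
  rewrite -leqNgt => Ni; split => x // _.
  exact: (leq_trans (cell_nat_lt N l x) (Ni : (N < i.+1)%N)).
by split => x; rewrite /below /= in_itv/= -(cell_ltE l_incr x (ltn0Sn i) iN).
Qed.

Let measurable_below i : measurable (below i).
Proof. by rewrite belowE; case: i => // i; case: ifP. Qed.

Let prob_below j i : P (C j @^-1` below i) = (cdf_level i)%:E.
Proof.
rewrite belowE /cdf_level; case: i => [|i]; first by rewrite preimage_set0 measure0.
case: ifP => iN; last by rewrite preimage_setT probability_setT.
exact: cdfC.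
Qed.

Let in_cell (m : 'I_N.+1) : set R := [set x | cell N l x = m].

Let in_cellE m : in_cell m = below m.+1 `\` below m.
Proof.
apply/seteqP; split => x; rewrite /in_cell /below/=.
  by move=> <-; rewrite /= ltnS leqnn ltnn.
rewrite ltnS => -[xm /negP]; rewrite -leqNgt => mx.
by apply/val_inj/eqP; rewrite eqn_leq xm.
Qed.

Let measurable_in_cell m : measurable (in_cell m).
Proof. by rewrite in_cellE; apply: measurableD. Qed.

Let prob_in_cell j m : P (C j @^-1` in_cell m) = (cell_prob m)%:E.
Proof.
rewrite in_cellE (_ : _ @^-1` _ = C j @^-1` below m.+1 `\` C j @^-1` below m)//.
rewrite measureD; last 3 first.
- exact: measurable_funPTI.
- exact: measurable_funPTI.
- by have /= -> := prob_below j m.+1; rewrite ltry.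
rewrite setIidr; last first.
  by move=> w; rewrite /below/= => /ltn_trans; apply.
by have /= -> := prob_below j m.+1; have /= -> := prob_below j m.
Qed.

Lemma sum_cell_prob_ge k : (k <= N.+1)%N ->
  \sum_(m < N.+1 | (k <= m)%N) cell_prob m = 1 - cdf_level k.
Proof.
move=> kN.
rewrite -(big_mkord (fun m => k <= m)%N (fun m => cdf_level m.+1 - cdf_level m)).
transitivity (\sum_(k <= m < N.+1) (cdf_level m.+1 - cdf_level m)).
  by rewrite [RHS](@big_nat_widenl _ _ _ k 0).
by rewrite telescope_sumr// [cdf_level N.+1]/cdf_level ltnn.
Qed.

Lemma sum_cell_prob : \sum_m cell_prob m = 1.
Proof. by rewrite (@sum_cell_prob_ge 0)// subr0. Qed.

Lemma cell_prob_tail k : (k < N)%N -> tail_weight cell_prob k = 1 - F (l k.+1).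
Proof.
move=> kN; rewrite /tail_weight sum_cell_prob_ge ?ltnS 1?ltnW//.
by rewrite /cdf_level kN.
Qed.

(** The event is a finite disjoint union of boxes, one for each configuration of
    cells; mutual independence is used on boxes only. *)
Lemma prob_blackout_size k :
  P [set w | blackout_size l (fun j => C j w) = k] =
  (prod_weight cell_prob (fun f : {ffun 'I_N -> 'I_N.+1} =>
     [exists J : {set 'I_N}, halts (fun j => f j) [set: 'I_N] J && (#|J| == k)]))%:E.
Proof.
set G : pred {ffun _} := fun f => _.
pose atom (f : {ffun 'I_N -> 'I_N.+1}) := [set w | forall j, cell N l (C j w) = f j].
have -> : [set w | blackout_size l (fun j => C j w) = k] =
    \bigcup_(f in [set` G]) atom f.
  apply/seteqP; split => w /=.
    move=> /(blackout_sizeE l_incr) Gw.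
    exists [ffun j => cell N l (C j w)] => [/=|j]; last by rewrite ffunE.
    rewrite /G; move: Gw; congr (is_true _); apply: eq_existsb => J.
    by congr (_ && _); congr (halts _ _ _); apply/funext => j; rewrite ffunE.
  move=> [f /= Gf fw]; apply/(blackout_sizeE l_incr); move: Gf; rewrite /G.
  congr (is_true _); apply: eq_existsb => J; congr (_ && _).
  by congr (halts _ _ _); apply/funext => j; rewrite fw.
have atomE f : atom f =
    [set w | forall j, j \in [set: 'I_N]%SET -> in_cell (f j) (C j w)].
  by apply/seteqP; split => [w h j _|w h j]; [exact: h|apply: h; rewrite inE].
have Patom f : P (atom f) = (\prod_j cell_prob (f j))%:E.
  rewrite atomE.
  transitivity (\prod_(j in [set: 'I_N]%SET) P (C j @^-1` in_cell (f j)))%E.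
    exact: (indepC (fun j _ => measurable_in_cell (f j))).
  rewrite -prodEFin; apply: eq_big => [j|j _]; first by rewrite finset.in_setT.
  exact: prob_in_cell.
rewrite measure_fin_bigcup.
- rewrite -(@bigfs _ _ _ _ (index_enum _)) ?index_enum_uniq//; last first.
    by move=> f; rewrite mem_index_enum.
  by rewrite /prod_weight -sumEFin; apply: eq_bigr => f _; exact: Patom.
- exact: finite_finset.
- move=> f g _ _ [w [fw gw]]; apply/ffunP => j.
  by rewrite -fw -gw.
- move=> f _; rewrite (_ : atom f = \bigcap_(j in setT) (C j @^-1` in_cell (f j))).
    by apply: fin_bigcap_measurable => // j _; exact: measurable_funPTI.
  by apply/seteqP; split => [w h j _|w h j]; [exact: h|exact: (h j I)].
Qed.

End BlackoutProbability.

(** The bound theta + k <= N ensures that the minimum with 1 is not active at the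
    levels 1, ..., k + 1, the only ones that the event depends on. *)
Lemma quasi_binomial_blackout_size (d : measure_display) (T : measurableType d)
    (R : realType) (P : probability T R) (N k : nat)
    (C : 'I_N -> {RV P >-> R}) (F : R -> R) (l : nat -> R) (theta : R) :
  mutually_independent C ->
  (forall j r, cdf (C j) r = (F r)%:E) ->
  (forall i j : nat, (1 <= i)%N -> (i <= j)%N -> (j <= N)%N -> l i <= l j) ->
  (forall i : nat, (1 <= i)%N -> (i <= N)%N ->
     F (l i) = Num.min 1 ((theta + i%:R - 1) / N%:R)) ->
  (k < N)%N -> theta + k%:R <= N%:R ->
  N%:R ^+ N * fine (P [set w | blackout_size l (fun j => C j w) = k]) =
  'C(N, k)%:R * abel_coef k theta * (N%:R - theta - k%:R) ^+ (N - k).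
Proof.
move=> indepC cdfC l_incr Fl kN thetak.
have N0 : 0 < N%:R :> R by rewrite ltr0n (leq_ltn_trans _ kN).
rewrite (prob_blackout_size indepC cdfC l_incr)/=.
rewrite -[X in _ ^+ X * _]card_ord.
rewrite (prod_weight_halts_card (sum_cell_prob N F l) (x := theta) (n := k.+1))
  ?card_ord ?(ltnW kN)//.
move=> i; rewrite ltnS => ik; rewrite cell_prob_tail ?(leq_ltn_trans ik)//.
have iN : (i.+1 <= N)%N by rewrite (leq_ltn_trans ik).
have ikR : i%:R <= k%:R :> R by rewrite ler_nat.
rewrite Fl// -natr1 min_r; last by rewrite ler_pdivrMr// mul1r; lra.
by field; rewrite gt_eqF.
Qed.

(** * Asymptotics of the quasi-binomial law *)

Section Asymptotics.
Variable R : realType.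
Implicit Types (theta : R) (k m : nat).

Let s := stirling_ratio R.

(** After Stirling's formula, the scaled law factors into a part depending on the
    number k of failed lines and a part depending on the number m of surviving
    lines, up to the factor s(k + m). *)
Definition left_factor theta k : R :=
  k%:R / (theta + k%:R) * (1 + theta / k%:R) ^+ k / s k.

Definition right_factor theta m : R := (1 - theta / m%:R) ^+ m / s m.

Lemma scaled_quasi_binomialE theta k m : 0 < theta -> (0 < k)%N -> (0 < m)%N ->
  k%:R `^ (3 / 2) * Num.sqrt (1 - k%:R / (k + m)%:R) *
  ('C(k + m, k)%:R * abel_coef k theta * ((k + m)%:R - theta - k%:R) ^+ m
    / (k + m)%:R ^+ (k + m))
  = theta * (s (k + m) * (left_factor theta k * right_factor theta m)).
Proof.
move=> t0 k0 m0.
have km0 : (0 < k + m)%N by rewrite addn_gt0 k0.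
have sk := stirling_ratio_gt0 R k0; have sm := stirling_ratio_gt0 R m0.
have fE n : (0 < n)%N -> n`!%:R = s n * (Num.sqrt n%:R * (n%:R ^+ n / expR 1 ^+ n)).
  by move=> n0; rewrite (factE_stirling_ratio R n0) expr_div_n.
have -> : 'C(k + m, k)%:R = (k + m)`!%:R / (k`!%:R * m`!%:R) :> R.
  have kf j : j`!%:R != 0 :> R by rewrite pnatr_eq0 -lt0n fact_gt0.
  rewrite -(@bin_fact (k + m) k) ?leq_addr// addKn !natrM.
  by field; rewrite !kf.
rewrite !fE// /left_factor /right_factor -/s in sk sm *.
have x0 : 0 < k%:R :> R by rewrite ltr0n.
have y0 : 0 < m%:R :> R by rewrite ltr0n.
have -> : abel_coef k theta =
    theta * (k%:R ^+ k * (1 + theta / k%:R) ^+ k) / (theta + k%:R).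
  rewrite -exprMn (_ : k%:R * _ = theta + k%:R); last by field; rewrite gt_eqF.
  case: k k0 {km0 sk x0} => // i _ /=; rewrite exprS; field.
  by rewrite gt_eqF// addr_gt0.
have -> : ((k + m)%:R - theta - k%:R) ^+ m = m%:R ^+ m * (1 - theta / m%:R) ^+ m.
  by rewrite -exprMn natrD; congr (_ ^+ _); field; rewrite gt_eqF.
have -> : 1 - k%:R / (k + m)%:R = m%:R / (k + m)%:R :> R.
  by rewrite natrD; field; rewrite gt_eqF// addr_gt0.
have -> : k%:R `^ (3 / 2) = k%:R * Num.sqrt k%:R :> R.
  rewrite -powR12_sqrt ?(ltW x0)// (_ : 3 / 2 = 1 + 2^-1); last by field.
  by rewrite powRD ?powRr1 ?(ltW x0)// (gt_eqF x0) implybT.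
rewrite sqrtrM ?(ltW y0)// sqrtrV ?ler0n// (exprD (expR 1)).
have z0 : 0 < (k + m)%:R :> R by rewrite ltr0n.
have e0 n : 0 < expR 1 ^+ n :> R by rewrite exprn_gt0// expR_gt0.
have kk : 0 < k%:R ^+ k :> R by rewrite exprn_gt0.
have mm : 0 < m%:R ^+ m :> R by rewrite exprn_gt0.
have zz : 0 < (k + m)%:R ^+ (k + m) :> R by rewrite exprn_gt0.
move: (e0 k) (e0 m) kk mm zz.
move: (expR 1 ^+ k) (expR 1 ^+ m) (k%:R ^+ k) (m%:R ^+ m) ((k + m)%:R ^+ (k + m)).
move=> ek em kk mm zz ek0 em0 kk0 mm0 zz0.
move: ((1 + _) ^+ k) ((1 - _) ^+ m) => u v.
have : 0 < Num.sqrt k%:R :> R by rewrite sqrtr_gt0.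
have : 0 < Num.sqrt m%:R :> R by rewrite sqrtr_gt0.
have : 0 < Num.sqrt (k + m)%:R :> R by rewrite sqrtr_gt0.
move: (Num.sqrt _) (Num.sqrt _) (Num.sqrt _) => a b c a0 b0 c0.
have tk : 0 < theta + k%:R by rewrite addr_gt0.
by field; rewrite !gt_eqF.
Qed.

Lemma left_factor_cvg theta : left_factor theta @ \oo --> expR theta / Num.sqrt (2 * pi).
Proof.
have pi20 : Num.sqrt (2 * pi) != 0 :> R.
  by rewrite gt_eqF// sqrtr_gt0 mulr_gt0 ?pi_gt0.
apply: cvgM; last by apply: cvgV => //; exact: stirling_ratio_cvg.
rewrite -[X in _ --> X]mul1r; apply: cvgM; last exact: cvg_expn_expR.
have h : (1 + theta / k%:R)^-1 @[k --> \oo] --> (1 : R).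
  rewrite -[X in _ --> X]invr1 -[X in X^-1](addr0 1).
  apply: cvgV; first by rewrite addr0 oner_neq0.
  apply: cvgD; first exact: cvg_cst.
  rewrite -[X in _ --> X](mulr0 theta).
  by apply: cvgMl_tmp; rewrite -cvg_shiftS; exact: cvg_harmonic.
apply: cvg_trans h; apply: near_eq_cvg; near=> k.
have k0 : k%:R != 0 :> R by rewrite pnatr_eq0 -lt0n; near: k; exact: nbhs_infty_gt.
by rewrite -[in RHS]invf_div mulrDl divff// addrC.
Unshelve. all: by end_near. Qed.

Lemma right_factor_cvg theta :
  right_factor theta @ \oo --> expR (- theta) / Num.sqrt (2 * pi).
Proof.
have pi20 : Num.sqrt (2 * pi) != 0 :> R.
  by rewrite gt_eqF// sqrtr_gt0 mulr_gt0 ?pi_gt0.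
apply: cvgM; last by apply: cvgV => //; exact: stirling_ratio_cvg.
have -> : (fun m => (1 - theta / m%:R) ^+ m) = (fun m => (1 + - theta / m%:R) ^+ m).
  by apply/funext => m; rewrite mulNr.
exact: cvg_expn_expR.
Qed.

(** The two factors e^theta and e^(-theta) cancel. The limit is along pairs (k, m)
    with both components large, which is what uniformity in k amounts to. *)
Lemma scaled_quasi_binomial_cvg theta :
  theta * (s (p.1 + p.2) * (left_factor theta p.1 * right_factor theta p.2))
    @[p --> (\oo, \oo)] --> theta / Num.sqrt (2 * pi).
Proof.
have pi20 : Num.sqrt (2 * pi) != 0 :> R.
  by rewrite gt_eqF// sqrtr_gt0 mulr_gt0 ?pi_gt0.
rewrite (_ : theta / _ = theta * (Num.sqrt (2 * pi) *
  (expR theta / Num.sqrt (2 * pi) * (expR (- theta) / Num.sqrt (2 * pi))))); last first.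
  rewrite expRN; field; by rewrite pi20 gt_eqF ?expR_gt0.
apply: cvgMl_tmp; apply: cvgM.
  apply: (cvg_comp _ _ _ (@stirling_ratio_cvg R)).
  apply/cvgnyPge => M.
  exists ([set k | M <= k]%N, setT).
    by split; [exact: nbhs_infty_ge|exact: filterT].
  by move=> [k m] /= [Mk _]; rewrite (leq_trans Mk) ?leq_addr.
apply: cvgM.
  exact: (cvg_comp _ _ cvg_fst (@left_factor_cvg theta)).
exact: (cvg_comp _ _ cvg_snd (@right_factor_cvg theta)).
Qed.

End Asymptotics.

Theorem theorem1 (R : realType)
    (d : nat -> measure_display) (T : forall N : nat, measurableType (d N))
    (P : forall N : nat, probability (T N) R)
    (C : forall N : nat, 'I_N -> {RV (P N) >-> R})
    (F : R -> R) (l : nat -> nat -> R) (theta : R) (k_lo k_hi : nat -> R)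
    (indepC : forall N : nat, mutually_independent (C N))
    (cdfC : forall (N : nat) (j : 'I_N) (r : R), cdf (C N j) r = (F r)%:E)
    (contF : continuous F)
    (densF : positive_density_at0 F)
    (l_incr : forall N i j : nat,
       (1 <= i)%N -> (i <= j)%N -> (j <= N)%N -> l N i <= l N j)
    (theta_gt0 : 0 < theta)
    (Fl : forall N i : nat, (1 <= i)%N -> (i <= N)%N ->
       F (l N i) = Num.min 1 ((theta + i%:R - 1) / N%:R))
    (k_lo_hi : forall N : nat, k_lo N <= k_hi N)
    (k_lo_oo : k_lo N @[N --> \oo] --> +oo)
    (k_hi_oo : (N%:R - k_hi N) @[N --> \oo] --> +oo) :
  sup [set `| k%:R `^ (3 / 2) * Num.sqrt (1 - k%:R / N%:R)
              * fine (P N [set w | blackout_size (l N) (fun j => C N j w) = k])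
              - theta / Num.sqrt (2 * pi) |
      | k in [set k : nat | k_lo N <= k%:R <= k_hi N] ]
    @[N --> \oo] --> (0 : R).
Proof.
apply/cvgrPdist_le => eps eps0.
have /cvgrPdist_le/(_ eps eps0)[[A B] [/= [K _ KA] [M _ MB]] ABeps] :=
  @scaled_quasi_binomial_cvg R theta.
move/cvgryPge : k_lo_oo => /(_ K.+1%:R) k_lo_ge.
move/cvgryPge : k_hi_oo => /(_ (M.+1%:R + theta)) k_hi_ge.
near=> N; rewrite sub0r normrN; set S := image _ _.
have Seps x : S x -> 0 <= x <= eps.
  move=> [k /= /andP[k_lok kk_hi] <-]; rewrite normr_ge0/= distrC.
  (* k and N - k exceed the thresholds K and M for every k in the range *)
  have Kk : (K < k)%N.
    by rewrite -(ler_nat R); apply: le_trans k_lok; near: N.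
  have MN : M.+1%:R + theta <= N%:R - k%:R.
    by apply: (@le_trans _ _ (N%:R - k_hi N)); [near: N|rewrite lerB].
  have M1 : 0 <= M%:R :> R := ler0n R M.
  have kN : (k < N)%N by rewrite -(ltr_nat R); move: MN; rewrite -natr1; lra.
  have NE : N = (k + (N - k))%N by rewrite subnKC// ltnW.
  have tkN : theta + k%:R <= N%:R by move: MN; rewrite -natr1; lra.
  have MNk : (M < N - k)%N.
    by rewrite -(ltr_nat R) natrB ?(ltnW kN)//; move: MN; rewrite -natr1; lra.
  have := ABeps (k, (N - k)%N); rewrite /= -scaled_quasi_binomialE//; last 2 first.
  - exact: leq_ltn_trans Kk.
  - exact: leq_ltn_trans MNk.
  rewrite -NE => /(_ (conj (KA _ (ltnW Kk)) (MB _ (ltnW MNk)))).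
  rewrite -(quasi_binomial_blackout_size (indepC N) (cdfC N) (l_incr N) (Fl N) kN tkN).
  have NN0 : N%:R ^+ N != 0 :> R.
    by rewrite expf_neq0// pnatr_eq0 -lt0n (leq_ltn_trans _ kN).
  by rewrite [_ / _ ^+ N]mulrC mulKf.
have [->|/set0P[x Sx]] := eqVneq S set0; first by rewrite sup0 normr0 ltW.
have Sub : ubound S eps by move=> y /Seps /andP[].
rewrite ger0_norm; first by apply: ge_sup => //; exists x.
have /andP[x0 _] := Seps _ Sx; apply: le_trans x0 _.
by apply: ub_le_sup => //; exists eps.
Unshelve. all: by end_near. Qed.
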